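(* Let $f:\Omega_D\to\mathbb{H}$ be a slice regular function, let $x_0\in\Omega_D$, and let $f(x)=\sum_{n\in\mathbb{N}}\mathcal{S}_{x_0,n}(x)s_n$ be the spherical expansion of $f$ centered at $x_0$. Then $$s_2=\left(\frac{\partial}{\partial x}(\partial_s f)\right)(x_0).$$
   Context: $\mathbb{H}$ is the real algebra of quaternions and $\mathbb{S}=\{q\in\mathbb{H} : q^2=-1\}$; every $x\in\mathbb{H}$ can be written $x=\alpha+J\beta$ with $\alpha,\beta\in\mathbb{R}$, $J\in\mathbb{S}$, its conjugate is $x^c=\alpha-J\beta$ and $\mathrm{Im}(x)=J\beta$. $D\subset\mathbb{C}$ is an open set symmetric with respect to the real axis, and $\Omega_D:=\{\alpha+J\beta : \alpha+i\beta\in D,\ J\in\mathbb{S}\}$. Let $\mathbb{H}_{\mathbb{C}}=\mathbb{H}\otimes_{\mathbb{R}}\mathbb{C}=\{p+\sqrt{-1}q : p,q\in\mathbb{H}\}$. A stem function on $D$ is a map $F=F_1+\sqrt{-1}F_2:D\to\mathbb{H}_{\mathbb{C}}$ ($F_1,F_2$ being $\mathbb{H}$-valued) with $F_1(\bar z)=F_1(z)$, $F_2(\bar z)=-F_2(z)$; it induces the slice function $f=\mathcal{I}(F):\Omega_D\to\mathbb{H}$, $f(\alpha+J\beta):=F_1(\alpha+i\beta)+JF_2(\alpha+i\beta)$. The slice function $f=\mathcal{I}(F)$ is slice regular if $F$ is $\mathcal{C}^1$ and $\frac{\partial F}{\partial\bar z}=\frac12\left(\frac{\partial F}{\partial\alpha}+\sqrt{-1}\frac{\partial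 F}{\partial\beta}\right)\equiv 0$. For a slice function $f=\mathcal{I}(F)$ with $F$ of class $\mathcal{C}^1$, the slice derivative is $\frac{\partial f}{\partial x}:=\mathcal{I}\left(\frac{\partial F}{\partial z}\right)$ with $\frac{\partial F}{\partial z}=\frac12\left(\frac{\partial F}{\partial\alpha}-\sqrt{-1}\frac{\partial F}{\partial\beta}\right)$. The spherical derivative is $\partial_s f(x):=\frac12\mathrm{Im}(x)^{-1}(f(x)-f(x^c))$ for $x\in\Omega_D\setminus\mathbb{R}$; it is the slice function induced by $z\mapsto F_2(z)/\mathrm{Im}(z)$. When $f$ is slice regular and $\Omega_D\cap\mathbb{R}\neq\emptyset$, $\partial_s f$ and $\frac{\partial}{\partial x}\partial_s f$ extend continuously to $\Omega_D$, and at real points the symbols denote these extensions. Spherical expansion: for $y\in\mathbb{H}$ put $\Delta_y(x)=x^2-x(y+y^c)+yy^c$ and, for $m\in\mathbb{N}=\{0,1,2,\dots\}$, $\mathcal{S}_{y,2m}(x)=\Delta_y(x)^m$, $\mathcal{S}_{y,2m+1}(x)=\Delta_y(x)^m(x-y)$. Every slice regular $f$ on $\Omega_D$ is spherical analytic: for each $y\in\Omega_D$ there are $R>0$ with $U(y,R)=\{x\in\mathbb{H} : \sqrt{\|\Delta_y(x)\|}<R\}\subset\Omega_D$ and coefficients $s_n\in\mathbb{H}$ such that $f(x)=\sum_{n\in\mathbb{N}}\mathcal{S}_{y,n}(x)s_n$ for all $x\in U(y,R)$; this series is the spherical expansion of $f$ centered at $y$. *)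

(* Defs.v *)
From HB Require Import structures.
From mathcomp Require Import all_boot all_order all_algebra.
From mathcomp Require Import ring lra.
From mathcomp Require Import all_classical all_reals all_analysis.

Set Implicit Arguments.
Unset Strict Implicit.
Unset Printing Implicit Defensive.

Import Order.TTheory GRing.Theory Num.Theory.
Import numFieldNormedType.Exports.

Local Open Scope classical_set_scope.
Local Open Scope ring_scope.

(* [Quat a b c d] is a + b i + c j + d k. *)
Record quat (R : Type) := Quat { qre : R; qi : R; qj : R; qk : R }.

Section QuatChoice.
Context (R : choiceType).

Definition quat_tuple (x : quat R) := (qre x, qi x, qj x, qk x).
Definition tuple_quat (t : R * R * R * R) :=
  let: (a, b, c, d) := t in Quat a b c d.

Lemma quat_tupleK : cancel quat_tuple tuple_quat.
Proof. by case. Qed.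

HB.instance Definition _ := Choice.copy (quat R) (can_type quat_tupleK).

End QuatChoice.

Section QuatAlgebra.
Context (R : realType).
Implicit Types x y z : quat R.

Definition quat_opp x := Quat (- qre x) (- qi x) (- qj x) (- qk x).
Definition quat_add x y :=
  Quat (qre x + qre y) (qi x + qi y) (qj x + qj y) (qk x + qk y).

Let quat_addA : associative quat_add.
Proof. by move=> [????] [????] [????]; congr Quat => /=; ring. Qed.
Let quat_addC : commutative quat_add.
Proof. by move=> [????] [????]; congr Quat => /=; ring. Qed.
Let quat_add0 : left_id (Quat 0 0 0 0) quat_add.
Proof. by move=> [????]; congr Quat => /=; ring. Qed.
Let quat_addN : left_inverse (Quat 0 0 0 0) quat_opp quat_add.
Proof. by move=> [????]; congr Quat => /=; ring. Qed.

HB.instance Definition _ := GRing.isZmodule.Build (quat R)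
  quat_addA quat_addC quat_add0 quat_addN.

Definition quat_mul x y := Quat
  (qre x * qre y - qi x * qi y - qj x * qj y - qk x * qk y)
  (qre x * qi y + qi x * qre y + qj x * qk y - qk x * qj y)
  (qre x * qj y - qi x * qk y + qj x * qre y + qk x * qi y)
  (qre x * qk y + qi x * qj y - qj x * qi y + qk x * qre y).

Let quat_mulA : associative quat_mul.
Proof. by move=> [????] [????] [????]; congr Quat => /=; ring. Qed.
Let quat_mul1l : left_id (Quat 1 0 0 0) quat_mul.
Proof. by move=> [????]; congr Quat => /=; ring. Qed.
Let quat_mul1r : right_id (Quat 1 0 0 0) quat_mul.
Proof. by move=> [????]; congr Quat => /=; ring. Qed.
Let quat_mulDl : left_distributive quat_mul +%R.
Proof. by move=> [????] [????] [????]; congr Quat => /=; ring. Qed.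
Let quat_mulDr : right_distributive quat_mul +%R.
Proof. by move=> [????] [????] [????]; congr Quat => /=; ring. Qed.
Let quat_one_neq0 : Quat 1 0 0 0 != 0 :> quat R.
Proof. by apply/eqP => -[/eqP]; rewrite oner_eq0. Qed.

HB.instance Definition _ := GRing.Zmodule_isNzRing.Build (quat R)
  quat_mulA quat_mul1l quat_mul1r quat_mulDl quat_mulDr quat_one_neq0.

Definition quat_scale (a : R) x := Quat (a * qre x) (a * qi x) (a * qj x) (a * qk x).

Let quat_scaleA a b x : quat_scale a (quat_scale b x) = quat_scale (a * b) x.
Proof. by case: x => ????; congr Quat => /=; ring. Qed.
Let quat_scale1 : left_id 1 quat_scale.
Proof. by move=> [????]; congr Quat => /=; ring. Qed.
Let quat_scaleDr : right_distributive quat_scale +%R.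
Proof. by move=> a [????] [????]; congr Quat => /=; ring. Qed.
Let quat_scaleDl x : {morph quat_scale^~ x : a b / a + b}.
Proof. by move=> a b; case: x => ????; congr Quat => /=; ring. Qed.

HB.instance Definition _ := GRing.Zmodule_isLmodule.Build R (quat R)
  quat_scaleA quat_scale1 quat_scaleDr quat_scaleDl.

Let quat_scaleAl (a : R) x y : a *: (x * y) = (a *: x) * y.
Proof. by case: x => ????; case: y => ????; congr Quat => /=; ring. Qed.
HB.instance Definition _ :=
  GRing.Lmodule_isLalgebra.Build R (quat R) quat_scaleAl.

Let quat_scaleAr (a : R) x y : a *: (x * y) = x * (a *: y).
Proof. by case: x => ????; case: y => ????; congr Quat => /=; ring. Qed.
HB.instance Definition _ :=
  GRing.Lalgebra_isAlgebra.Build R (quat R) quat_scaleAr.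

Definition quat_conj x := Quat (qre x) (- qi x) (- qj x) (- qk x).
Definition quat_im x := Quat 0 (qi x) (qj x) (qk x).
Definition quat_normsq x := qre x ^+ 2 + qi x ^+ 2 + qj x ^+ 2 + qk x ^+ 2.

Lemma quat_normsq_ge0 x : 0 <= quat_normsq x.
Proof. by rewrite !addr_ge0// sqr_ge0. Qed.

Lemma quat_normsq_eq0 x : (quat_normsq x == 0) = (x == 0).
Proof.
apply/eqP/eqP => [|->]; last by rewrite /quat_normsq/= expr0n/= !addr0.
case: x => a b c d /eqP; rewrite /quat_normsq/=.
rewrite !paddr_eq0 ?addr_ge0 ?sqr_ge0// !sqrf_eq0.
by move=> /andP[/andP[/andP[/eqP-> /eqP->] /eqP->] /eqP->].
Qed.

Definition quat_inv x :=
  if x == 0 then x else (quat_normsq x)^-1 *: quat_conj x.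

Let quat_mulVx : {in [pred x | x != 0], left_inverse 1 quat_inv *%R}.
Proof.
move=> x; rewrite inE => x0; rewrite /quat_inv (negbTE x0).
move: x0; rewrite -quat_normsq_eq0.
case: x => a b c d; rewrite /quat_normsq/= => n0.
by congr Quat => /=; field.
Qed.
Let quat_mulxV : {in [pred x | x != 0], right_inverse 1 quat_inv *%R}.
Proof.
move=> x; rewrite inE => x0; rewrite /quat_inv (negbTE x0).
move: x0; rewrite -quat_normsq_eq0.
case: x => a b c d; rewrite /quat_normsq/= => n0.
by congr Quat => /=; field.
Qed.
Let quat_unitP x y : y * x = 1 /\ x * y = 1 -> [pred x | x != 0] x.
Proof.
move=> [yx1 _] /=; apply/eqP => x0; move/eqP: yx1.
by rewrite x0 mulr0 eq_sym oner_eq0.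
Qed.
Let quat_inv_out : {in [predC [pred x | x != 0]], quat_inv =1 id}.
Proof. by move=> x; rewrite !inE negbK /quat_inv => ->. Qed.

HB.instance Definition _ := GRing.NzRing_hasMulInverse.Build (quat R)
  quat_mulVx quat_mulxV quat_unitP quat_inv_out.

Definition quat_norm x : R := Num.sqrt (quat_normsq x).

Let quat_norm_triangle x y : quat_norm (x + y) <= quat_norm x + quat_norm y.
Proof.
have N0 := quat_normsq_ge0.
rewrite -(@ler_pXn2r _ 2)// ?nnegrE ?addr_ge0 ?sqrtr_ge0//.
rewrite sqrrD !sqr_sqrtr// -sqrtrM//.
set p := quat_normsq x * quat_normsq y.
pose t := qre x * qre y + qi x * qi y + qj x * qj y + qk x * qk y.
suff tp : t <= Num.sqrt p.
  have -> : quat_normsq (x + y) = quat_normsq x + t *+ 2 + quat_normsq y.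
    by rewrite /quat_normsq /t; case: (x) => ????; case: (y) => ????/=; ring.
  by rewrite lerD2r lerD2l lerMn2r tp orbT.
apply: (le_trans (ler_norm t)); rewrite -sqrtr_sqr ler_wsqrtr//.
rewrite /p /t /quat_normsq; case: (x) => a b c d; case: (y) => a' b' c' d'/=.
rewrite -subr_ge0; set u := (_ - _).
have -> : u = (a * b' - b * a') ^+ 2 + (a * c' - c * a') ^+ 2
            + (a * d' - d * a') ^+ 2 + (b * c' - c * b') ^+ 2
            + (b * d' - d * b') ^+ 2 + (c * d' - d * c') ^+ 2.
  by rewrite /u; ring.
by rewrite !addr_ge0// sqr_ge0.
Qed.
Let quat_normZ (a : R) x : quat_norm (a *: x) = `|a| * quat_norm x.
Proof.
rewrite /quat_norm -sqrtr_sqr -sqrtrM ?sqr_ge0//; congr Num.sqrt.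
by rewrite /quat_normsq; case: x => ????/=; ring.
Qed.
Let quat_norm0_eq0 x : quat_norm x = 0 -> x = 0.
Proof.
move=> /eqP; rewrite sqrtr_eq0 => n0; apply/eqP.
by rewrite -quat_normsq_eq0 eq_le n0 quat_normsq_ge0.
Qed.

HB.instance Definition _ := Lmodule_isNormed.Build R (quat R)
  quat_norm_triangle quat_normZ quat_norm0_eq0.

End QuatAlgebra.

Section SliceFunctions.
Context (R : realType).
(* The complex plane is R * R, with (a, b) standing for a + ib, and a pair
   (p, q) : quat R * quat R stands for p + sqrt(-1) q in H (x) C. *)
Implicit Types (D : set (R * R)) (F : R * R -> quat R * quat R)
  (f g : quat R -> quat R).

Definition conj_symmetric D := forall a b, D (a, b) -> D (a, - b).

Definition imag_unit : set (quat R) := [set J | J ^+ 2 = -1].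

Definition Omega D : set (quat R) :=
  [set x | exists a b J, [/\ D (a, b), imag_unit J & x = a%:A + b *: J]].

Definition is_stem D F := forall a b, D (a, b) ->
  (F (a, - b)).1 = (F (a, b)).1 /\ (F (a, - b)).2 = - (F (a, b)).2.

(* f = I(F) on Omega D *)
Definition induces D F f := forall a b J, D (a, b) -> imag_unit J ->
  f (a%:A + b *: J) = (F (a, b)).1 + J * (F (a, b)).2.

Definition is_C1 D F := forall z, D z ->
  [/\ derivable F z (1, 0), derivable F z (0, 1),
      {for z, continuous (fun w => 'D_(1, 0) F w)} &
      {for z, continuous (fun w => 'D_(0, 1) F w)}].

Definition sqrtN1_mul (w : quat R * quat R) := (- w.2, w.1).

Definition d_z F z :=
  (2^-1 : R) *: ('D_(1, 0) F z - sqrtN1_mul ('D_(0, 1) F z)).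
Definition d_zbar F z :=
  (2^-1 : R) *: ('D_(1, 0) F z + sqrtN1_mul ('D_(0, 1) F z)).

Definition slice_regular D f := exists F,
  [/\ is_stem D F, induces D F f, is_C1 D F &
      forall z, D z -> d_zbar F z = 0].

(* I(F) as a function on the whole of H, through the normal form
   x = Re x + (Im x / |Im x|) |Im x|.  At a real x the unit is replaced by 0,
   which is harmless for a stem function since F_2 vanishes there:
   see [slice_fun_induces]. *)
Definition slice_fun F : quat R -> quat R := fun x =>
  let z := (qre x, `|quat_im x|) in
  (F z).1 + (`|quat_im x|^-1 *: quat_im x) * (F z).2.

(* The stem function of f on D, unique on D by [induces_inj]. *)
Definition stem_of D f : R * R -> quat R * quat R :=
  xget (fun=> 0) [set F | is_stem D F /\ induces D F f].

Definition slice_derivative D f : quat R -> quat R :=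
  slice_fun (d_z (stem_of D f)).

Definition spherical_derivative f : quat R -> quat R := fun x =>
  (2^-1 : R) *: ((quat_im x)^-1 * (f x - f (quat_conj x))).

(* Omega (off_real D) is Omega D minus the reals. *)
Definition off_real D : set (R * R) := [set z | D z /\ z.2 != 0].

(* The filter of the punctured approach x -> y, x in Omega D minus the reals. *)
Definition nonreal_nbhs D (y : quat R) : set_system (quat R) :=
  within (Omega (off_real D)) (nbhs y).

(* The value at y of a function g given on Omega D minus the reals, extended by
   continuity at the real points. *)
Definition real_extension D g : quat R -> quat R := fun y =>
  if quat_im y == 0 then lim (g x @[x --> nonreal_nbhs D y]) else g y.

Definition Delta (y x : quat R) : quat R :=
  x ^+ 2 - x * (y + quat_conj y) + y * quat_conj y.

Definition spherical_basis (y : quat R) (n : nat) (x : quat R) : quat R :=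
  if odd n then Delta y x ^+ n./2 * (x - y) else Delta y x ^+ n./2.

Definition Cassini_ball (y : quat R) (r : R) : set (quat R) :=
  [set x | Num.sqrt `|Delta y x| < r].

Definition is_spherical_expansion D f (y : quat R) (s : nat -> quat R) :=
  exists r : R, [/\ 0 < r, Cassini_ball y r `<=` Omega D &
    forall x, Cassini_ball y r x ->
      series (fun n => spherical_basis y n x * s n) @ \oo --> f x].

Lemma quat_normE (x : quat R) : `|x| = Num.sqrt (quat_normsq x).
Proof. by []. Qed.

Lemma imag_unitP (J : quat R) :
  imag_unit J <-> qre J = 0 /\ quat_normsq J = 1.
Proof.
case: J => a b c d; rewrite /imag_unit /quat_normsq /= expr2.
split=> [[h1 h2 h3 h4]|[-> n1]].
  have a0 : a = 0.
    apply/eqP; apply: contraT => a0.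
    have z0 t : a * t + t * a = 0 -> t = 0.
      move=> /eqP; rewrite [t * a]mulrC -mulr2n mulrn_eq0/= mulf_eq0 (negbTE a0).
      by move=> /eqP.
    have b0 : b = 0 by apply: z0; rewrite -[RHS]oppr0 -h2; ring.
    have c0 : c = 0 by apply: z0; rewrite -[RHS]oppr0 -h3; ring.
    have d0 : d = 0 by apply: z0; rewrite -[RHS]oppr0 -h4; ring.
    by move: h1; rewrite b0 c0 d0 => h1; have := sqr_ge0 a; nra.
  by split=> //; move: h1; rewrite a0 => h1; nra.
by congr Quat => /=; [rewrite -n1| | |]; ring.
Qed.

Lemma slice_fun_induces D F : is_stem D F -> induces D F (slice_fun F).
Proof.
move=> stF a b J Dab /imag_unitP[].
case: J => j0 j1 j2 j3 /= -> nJ; rewrite /slice_fun.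
set J := Quat 0 j1 j2 j3; set x := (a%:A + b *: J).
have imx : quat_im x = b *: J.
  by rewrite /x /J /quat_im; congr Quat => /=; ring.
have rex : qre x = a by rewrite /x /J /=; ring.
have nJ1 : `|J| = 1 by rewrite quat_normE nJ sqrtr1.
rewrite imx rex normrZ nJ1 mulr1.
have [b0|b0|b0] := ltgtP b 0.
- rewrite ltr0_norm//; have [-> ->] := stF _ _ Dab.
  rewrite mulrN -mulNr; congr (_ + _ * _).
  by rewrite scalerA invrN mulNr mulVf ?lt_eqF// scaleN1r opprK.
- by rewrite gtr0_norm// scalerA mulVf ?gt_eqF// scale1r.
- rewrite b0 normr0 in Dab *; have [_] := stF _ _ Dab; rewrite oppr0 => h.
  suff -> : (F (a, 0)).2 = 0 by rewrite !mulr0.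
  have : (F (a, 0)).2 *+ 2 = 0 by rewrite mulr2n {1}h addNr.
  rewrite -scaler_nat => /eqP; rewrite scaler_eq0 pnatr_eq0/=.
  by move=> /eqP.
Qed.

Lemma induces_inj D F G f : induces D F f -> induces D G f ->
  forall z, D z -> F z = G z.
Proof.
move=> Ff Gf [a b] Dab.
pose J : quat R := Quat 0 1 0 0.
have SJ : imag_unit J by apply/imag_unitP; rewrite /quat_normsq/=; split=> //; ring.
have SNJ : imag_unit (- J) by rewrite /imag_unit/= sqrrN.
have := Gf a b J Dab SJ; have := Gf a b _ Dab SNJ.
rewrite (Ff a b J Dab SJ) (Ff a b _ Dab SNJ).
case: (F (a, b)) (G (a, b)) => [F1 F2] [G1 G2] /=; rewrite !mulNr => e1 e2.
have E1 : F1 = G1.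
  have : F1 *+ 2 = G1 *+ 2.
    rewrite !mulr2n -[LHS](subrKA (J * F2)) -[RHS](subrKA (J * G2)).
    by rewrite e1 addrC [X in X + _]addrC e2 addrC [X in _ + X]addrC.
  move=> /eqP; rewrite -subr_eq0 -mulrnBl -scaler_nat scaler_eq0 pnatr_eq0/=.
  by rewrite subr_eq0 => /eqP.
congr (_, _) => //; move: e2; rewrite E1 => /addrI /(congr1 ( *%R (- J))).
by rewrite !mulrA mulNr -expr2 SJ opprK !mul1r.
Qed.

End SliceFunctions.

(* Main.v *)
(* Let g(a + ib) = F_2(a + ib) / b be the stem function of the spherical derivative,
   so that dsf = (d_a g - J d_b g) / 2.

   At a nonreal x0 = a0 + J b0, truncate the expansion after the term of index 3.
   The remainder is O(|Delta|^2), hence quadratic in the distance to (a0, b0), and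
   does not contribute to the first derivatives of g.  The truncation gives
   d_a g = 2 s_2 - 2 b0 J s_3 and d_b g = - 2 b0 s_3, so that the s_3 cancel.

   At a real x0, g is a power series g = sum_n u_n s_n with polynomials u_n; its tail
   of order n >= 3 has a small Lipschitz constant near x0, so that d_a g -> 2 s_2 and
   d_b g -> 0. *)
Require Import Defs.
From HB Require Import structures.
From mathcomp Require Import all_boot all_order all_algebra.
From mathcomp Require Import ring lra.
From mathcomp Require Import all_classical all_reals all_analysis.

Set Implicit Arguments.
Unset Strict Implicit.
Unset Printing Implicit Defensive.

Import Order.TTheory GRing.Theory Num.Theory.
Import numFieldNormedType.Exports.

Local Open Scope classical_set_scope.
Local Open Scope ring_scope.

(** * Tails and regrouping of convergent series *)

Section Series.
Context (R : realType) (V : normedModType R).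
Implicit Types (u : nat -> V) (l : V).

(** Since q <= 1/2, each q^k is at most 2 q^k - 2 q^(k+1), and the sum telescopes. *)
Lemma sum_geometric_tail (q : R) m n : 0 <= q <= 2^-1 -> (m <= n)%N ->
  \sum_(m <= k < n) q ^+ k <= 2 * q ^+ m - 2 * q ^+ n.
Proof.
move=> /andP[q0 q2] /subnKC <-; elim: (n - m)%N => [|k IH].
  by rewrite addn0 big_geq// subrr.
rewrite addnS big_nat_recr ?leq_addr//= exprS.
have := exprn_ge0 (m + k) q0; set a := q ^+ (m + k) in IH *; nra.
Qed.

(** The geometric majorant bounds every difference of partial sums, and the bound passes to the
    limit; the 2 bounds 1/(1 - q). *)
Lemma cvg_series_tail u l (K q : R) m : 0 <= K -> 0 <= q <= 2^-1 ->
  (forall n, (m <= n)%N -> `|u n| <= K * q ^+ n) -> series u @ \oo --> l ->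
  `|l - series u m| <= 2 * K * q ^+ m.
Proof.
move=> K0 qP uK ul.
apply: (cvgr_to_le (cvg_norm (cvgB ul (cvg_cst (series u m))))); near=> n.
have mn : (m <= n)%N by near: n; exact: nbhs_infty_ge.
rewrite -[leLHS]/(`|series u n - series u m|) sub_series_geq//.
apply: (le_trans (ler_norm_sum _ _ _)).
apply: (@le_trans _ _ (\sum_(m <= k < n) K * q ^+ k)).
  by rewrite big_nat [leRHS]big_nat; apply: ler_sum => k /andP[mk _]; exact: uK.
rewrite -mulr_sumr; have := sum_geometric_tail qP mn.
case/andP: qP => q0 _; have := exprn_ge0 n q0.
move: (\sum_(_ <= _ < _) _) (q ^+ n) (q ^+ m) => x y z; nra.
Unshelve. all: by end_near. Qed.

(** The terms of index 2n and 2n+1 of a spherical expansion share the factor Delta^n; the paired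
    partial sums form a subsequence of the original ones. *)
Lemma cvg_series_pair u l : series u @ \oo --> l ->
  series (fun n => u n.*2 + u n.*2.+1) @ \oo --> l.
Proof.
move=> ul.
have -> : series (fun n => u n.*2 + u n.*2.+1) = series u \o double.
  apply/funext; elim=> [|n IH]; first by rewrite /series /= !big_geq.
  rewrite /series /= doubleS !big_nat_recr//= addrA; congr (_ + _ + _).
  exact: IH.
apply: cvg_comp ul => A [N _ NA]; exists N => // n Nn.
by apply: NA => /=; rewrite (leq_trans Nn)// -addnn leq_addr.
Qed.

End Series.

(** * Quaternion norm and coordinates in a slice *)

Section Quaternions.
Context (R : realType).
Implicit Types (x y J : quat R) (a b : R).

Lemma quat_normM x y : `|x * y| = `|x| * `|y|.
Proof.
rewrite !quat_normE -sqrtrM ?quat_normsq_ge0//; congr Num.sqrt.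
by case: x => ????; case: y => ????; rewrite /quat_normsq /=; ring.
Qed.

Lemma quat_normX x n : `|x ^+ n| = `|x| ^+ n.
Proof.
elim: n => [|n IH]; last by rewrite !exprS quat_normM IH.
by rewrite !expr0 quat_normE /quat_normsq /= expr0n expr1n/= !addr0 sqrtr1.
Qed.

Lemma quat_normA a : `|a%:A : quat R| = `|a|.
Proof. by rewrite normrZ -(expr0 (1 : quat R)) quat_normX expr0 mulr1. Qed.

Lemma normr_qre_le x : `|qre x| <= `|x|.
Proof.
rewrite quat_normE -sqrtr_sqr ler_sqrt ?quat_normsq_ge0// /quat_normsq.
by rewrite -!addrA lerDl !addr_ge0// sqr_ge0.
Qed.

Lemma imag_unit_norm J : imag_unit J -> `|J| = 1.
Proof. by move=> /imag_unitP[_ nJ]; rewrite quat_normE nJ sqrtr1. Qed.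

(** For a fixed unit [J] these points form a commutative copy of the complex plane, so products
    reduce to real coordinates. *)
Definition slice_pt J a b : quat R := a%:A + b *: J.

Lemma slice_ptM J a b c d : imag_unit J ->
  slice_pt J a b * slice_pt J c d = slice_pt J (a * c - b * d) (a * d + b * c).
Proof.
move=> J1; rewrite /slice_pt mulrDl !mulrDr.
rewrite -!(scalerAl, scalerAr) !(mul1r, mulr1) -expr2 J1 !scalerA.
by rewrite scalerN [X in _ + X]addrC addrACA -scalerBl -scalerDl.
Qed.

Lemma slice_ptD J a b c d :
  slice_pt J a b + slice_pt J c d = slice_pt J (a + c) (b + d).
Proof. by rewrite /slice_pt addrACA !scalerDl. Qed.

Lemma slice_ptN J a b : - slice_pt J a b = slice_pt J (- a) (- b).
Proof. by rewrite /slice_pt opprD !scaleNr. Qed.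

Lemma slice_ptB J a b c d :
  slice_pt J a b - slice_pt J c d = slice_pt J (a - c) (b - d).
Proof. by rewrite slice_ptN slice_ptD. Qed.

Lemma slice_ptMl J a b x : slice_pt J a b * x = a *: x + b *: (J * x).
Proof. by rewrite /slice_pt mulrDl -!scalerAl mul1r. Qed.

Lemma slice_pt_real J a : slice_pt J a 0 = a%:A.
Proof. by rewrite /slice_pt scale0r addr0. Qed.

Lemma norm_slice_pt_le J a b : imag_unit J -> `|slice_pt J a b| <= `|a| + `|b|.
Proof.
move=> J1; apply: (le_trans (ler_normD _ _)).
by rewrite quat_normA normrZ (imag_unit_norm J1) mulr1.
Qed.

Lemma qre_slice_pt J a b : imag_unit J -> qre (slice_pt J a b) = a.
Proof. by case: J => ???? /imag_unitP[/= -> _]; ring. Qed.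

Lemma quat_im_slice_pt J a b : imag_unit J -> quat_im (slice_pt J a b) = b *: J.
Proof.
by case: J => ???? /imag_unitP[/= -> _]; congr Quat => /=; ring.
Qed.

Lemma quat_conj_slice_pt J a b :
  imag_unit J -> quat_conj (slice_pt J a b) = slice_pt J a (- b).
Proof.
by case: J => ???? /imag_unitP[/= -> _]; congr Quat => /=; ring.
Qed.

Lemma imag_unit_i : imag_unit (Quat 0 1 0 0 : quat R).
Proof. by apply/imag_unitP; rewrite /quat_normsq/=; split=> //; ring. Qed.

Lemma slice_ptV J b : imag_unit J -> b != 0 ->
  (b *: J)^-1 = slice_pt J 0 (- b^-1).
Proof.
move=> J1 b0.
have bJ : slice_pt J 0 (- b^-1) * (b *: J) = 1.
  have -> : b *: J = slice_pt J 0 b by rewrite /slice_pt scale0r add0r.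
  rewrite slice_ptM//.
  by rewrite !(mul0r, mulr0, addr0, add0r) mulNr mulVf// opprK slice_pt_real scale1r.
have bJ0 : b *: J != 0.
  by rewrite scaler_eq0 (negbTE b0)/= -normr_eq0 (imag_unit_norm J1) oner_eq0.
by rewrite -[RHS]mulr1 -(mulrV (x := b *: J))// mulrA bJ mul1r.
Qed.

Lemma slice_pt_decomp x : quat_im x != 0 ->
  imag_unit (`|quat_im x|^-1 *: quat_im x) /\
  x = slice_pt (`|quat_im x|^-1 *: quat_im x) (qre x) `|quat_im x|.
Proof.
move=> x0; have n0 : `|quat_im x| != 0 by rewrite normr_eq0.
split; last first.
  rewrite /slice_pt scalerA mulfV// scale1r.
  by case: x {x0 n0} => ????; congr Quat => /=; ring.
apply/imag_unitP; split; first by rewrite /= mulr0.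
transitivity (`|quat_im x| ^- 2 * quat_normsq (quat_im x)).
  by rewrite -exprVn; move: _^-1 => m; rewrite /quat_normsq /=; ring.
by rewrite quat_normE sqr_sqrtr ?quat_normsq_ge0// mulVf// quat_normsq_eq0.
Qed.

Lemma spherical_derivative_slice_pt f J a b : imag_unit J -> b != 0 ->
  spherical_derivative f (slice_pt J a b) =
  slice_pt J 0 (- (2 * b)^-1) * (f (slice_pt J a b) - f (slice_pt J a (- b))).
Proof.
move=> J1 b0; rewrite /spherical_derivative quat_im_slice_pt//.
rewrite quat_conj_slice_pt// slice_ptV// scalerAl; congr (_ * _).
by rewrite /slice_pt scalerDr !scalerA mulr0 invfM mulrN.
Qed.

(** In the slice of [J], Delta factors as (z - z0)(z - conj z0). *)
Lemma Delta_slice_pt J a0 b0 a b : imag_unit J ->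
  Delta (slice_pt J a0 b0) (slice_pt J a b) =
  slice_pt J ((a - a0) ^+ 2 + b0 ^+ 2 - b ^+ 2) (2 * (a - a0) * b).
Proof.
move=> J1; rewrite /Delta quat_conj_slice_pt// slice_ptD expr2 !slice_ptM//.
by rewrite slice_ptB slice_ptD; congr slice_pt; ring.
Qed.

(** The second factor has real part [a], hence norm at least |a|; this bounds Delta from below when
    the coefficients are estimated. *)
Lemma Delta_add_real x a :
  Delta x (x + a%:A) = a%:A * (a%:A + 2%:R *: quat_im x).
Proof. by case: x => ????; rewrite /Delta !expr2; congr Quat => /=; ring. Qed.

(* (a + J b)^n = t + J (b u) with (t, u) := slice_pow a b n; keeping the factor b
   out of u leaves a polynomial, which controls the spherical derivative of the
   n-th power up to the real axis. *)
Fixpoint slice_pow a b n : R * R :=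
  if n is m.+1 then
    let: (t, u) := slice_pow a b m in (a * t - b ^+ 2 * u, t + a * u)
  else (1, 0).

Lemma slice_ptX J a b n : imag_unit J ->
  slice_pt J a b ^+ n =
  slice_pt J (slice_pow a b n).1 (b * (slice_pow a b n).2).
Proof.
move=> J1; elim: n => [|n IH]; first by rewrite /= mulr0 slice_pt_real scale1r.
rewrite exprS IH slice_ptM//=; case: slice_pow => t u /=.
by congr slice_pt; ring.
Qed.

End Quaternions.

(** * Growth of the coefficients *)

Section Expansion.
Context (R : realType).
Implicit Types (D : set (R * R)) (f : quat R -> quat R) (x : quat R)
  (s : nat -> quat R).

Lemma Cassini_ballE x y (r : R) : 0 < r ->
  Cassini_ball x r y = (`|Delta x y| < r ^+ 2) :> Prop.
Proof.
move=> r0; rewrite /Cassini_ball /= -[in LHS](gtr0_norm r0) -sqrtr_sqr.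
by rewrite ltr_sqrt ?exprn_gt0.
Qed.

(* Convergence at x + t, where `|Delta x (x + t)| >= t^2, bounds the terms of the
   series there. *)
Lemma spherical_coef_bound D f x s : is_spherical_expansion D f x s ->
  exists C t : R, [/\ 0 <= C, 0 < t & forall n, `|s n| <= C * t^-1 ^+ n].
Proof.
move=> [r [r0 _ fs]]; set B := `|quat_im x|.
have B0 : 0 <= B by exact: normr_ge0.
(* t <= 1 bounds |t + 2 Im x| by 1 + 2 [B], and the other bound puts x + t in the Cassini ball. *)
pose t := Num.min 1 (r ^+ 2 / (2 * (1 + 2 * B))).
have t0 : 0 < t.
  by rewrite lt_min ltr01 divr_gt0 ?exprn_gt0// mulr_gt0// ltr_wpDr// mulr_ge0.
have t1 : t <= 1 by rewrite ge_min lexx.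
have tr : t * (1 + 2 * B) < r ^+ 2.
  have d0 : 0 < 1 + 2 * B by rewrite ltr_wpDr// mulr_ge0.
  rewrite -ltr_pdivlMr//; apply: (@le_lt_trans _ _ (r ^+ 2 / (2 * (1 + 2 * B)))).
    by rewrite ge_min lexx orbT.
  rewrite ltr_pM2l ?exprn_gt0// ltf_pV2 ?posrE ?mulr_gt0//; lra.
pose y := x + t%:A.
have nD : t ^+ 2 <= `|Delta x y| <= t * (1 + 2 * B).
  rewrite Delta_add_real quat_normM quat_normA gtr0_norm// expr2.
  rewrite !ler_pM2l//; apply/andP; split.
    apply: le_trans (normr_qre_le _); apply: le_trans (ler_norm _).
    by rewrite /= !mulr0 mulr1 addr0.
  apply: (le_trans (ler_normD _ _)).
  by rewrite quat_normA gtr0_norm// normrZ normr_nat lerD2r.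
case/andP: nD => nDl nDu.
have yr : Cassini_ball x r y by rewrite Cassini_ballE//; exact: le_lt_trans tr.
(* The terms of a convergent series tend to 0, hence are bounded. *)
have /cvgP/cvg_series_cvg_0/cvgP/cvg_seq_bounded sb := fs _ yr.
have [M Mb] : exists M, forall n, `|spherical_basis x n y * s n| <= M.
  have [M0 [_ M0b]] := sb; exists (M0 + 1) => n.
  by apply: M0b => //; rewrite ltrDl.
exists (Num.max 0 M), t; split=> //; first by rewrite le_max lexx.
move=> n; rewrite exprVn ler_pdivlMr ?exprn_gt0//.
apply: (@le_trans _ _ `|spherical_basis x n y * s n|); last first.
  by rewrite le_max (Mb n)// orbT.
(* An even index gives |Delta|^(n/2) >= t^n; an odd one has the extra factor y - x, of norm t. *)
rewrite quat_normM mulrC ler_wpM2r// -[n in leLHS]odd_double_half.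
rewrite /spherical_basis; case: odd; rewrite ?quat_normM ?quat_normX /=.
  rewrite add1n exprS -mul2n exprM mulrC.
  apply: ler_pM; rewrite ?exprn_ge0 ?(ltW t0)//.
    by rewrite lerXn2r// nnegrE// exprn_ge0// ltW.
  by rewrite /y addrAC subrr add0r quat_normA gtr0_norm.
by rewrite add0n -mul2n exprM lerXn2r// nnegrE// exprn_ge0// ltW.
Qed.

End Expansion.

(** * Derivatives along a direction *)

Section DirectionalDerivative.
Context (R : realType) (V W : normedModType R).
Implicit Types (f : V -> R) (g : V -> W) (z v : V).

(** The estimate divided by |h| passes to the limit of the difference quotients. An error k|h|
    instead of o(|h|) is enough, since k is made small later. *)
Lemma derive_dist_le g z v (l : W) (k : R) : derivable g z v ->
  (\forall h \near 0^', `|g (z + h *: v) - g z - h *: l| <= k * `|h|) ->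
  `|'D_v g z - l| <= k.
Proof.
move=> dg gk.
have cv : h^-1 *: ((g \o shift z) (h *: v) - g z) - l @[h --> 0^'] --> 'D_v g z - l.
  by apply: cvgB; [exact: dg|exact: cvg_cst].
apply: (cvgr_to_le (cvg_norm cv)); near=> h.
have h0 : h != 0 by near: h; exact: nbhs_dnbhs_neq.
rewrite -[X in _ - X](scalerK h0) -scalerBr normrZ normfV.
by rewrite ler_pdivrMl ?normr_gt0// mulrC /= [h *: v + z]addrC; near: h.
Unshelve. all: by end_near. Qed.

Lemma derivable_snd (z v : V * R) : derivable snd z v.
Proof.
apply/cvg_ex; exists v.2; apply: cvg_near_cst; near=> h.
have h0 : h != 0 by near: h; exact: nbhs_dnbhs_neq.
by rewrite /= addrK scalerK.
Unshelve. all: by end_near. Qed.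

Lemma derivable_scaler f g z v : derivable f z v -> derivable g z v ->
  derivable (fun w => f w *: g w) z v.
Proof.
move=> df dg; apply/cvg_ex; exists (f z *: 'D_v g z + 'D_v f z *: g z).
have h0 : (fun h : R => h) @ 0^' --> (0 : R).
  by apply: cvg_within_filter; exact: cvg_id.
have fz : f (h *: v + z) @[h --> 0^'] --> f z.
  have : h * (h^-1 *: ((f \o shift z) (h *: v) - f z)) + f z @[h --> 0^']
      --> 0 * 'D_v f z + f z.
    by apply: cvgD; [exact: cvgM h0 df|exact: cvg_cst].
  rewrite mul0r add0r; apply: cvg_trans; apply: near_eq_cvg; near=> h.
  have hn0 : h != 0 by near: h; exact: nbhs_dnbhs_neq.
  by rewrite /= /GRing.scale /= mulrA mulfV// mul1r subrK.
have : f (h *: v + z) *: (h^-1 *: ((g \o shift z) (h *: v) - g z)) +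
    (h^-1 *: ((f \o shift z) (h *: v) - f z)) *: g z @[h --> 0^']
    --> f z *: 'D_v g z + 'D_v f z *: g z.
  by apply: cvgD; apply: cvgZ => //; exact: cvg_cst.
apply: cvg_trans; apply: near_eq_cvg; near=> h => /=.
set u := f _; set w := g _; rewrite -[(h^-1 *: (u - f z)) *: g z](scalerA h^-1).
rewrite [u *: _]scalerA [u * _]mulrC -scalerA -scalerDr; congr (_ *: _).
by rewrite scalerBr scalerBl addrA subrK.
Unshelve. all: by end_near. Qed.

End DirectionalDerivative.

(** * Stem function of the spherical derivative *)

Section SphericalStem.
Context (R : realType) (D : set (R * R)) (f : quat R -> quat R)
  (F : R * R -> quat R * quat R).
Hypotheses (Dopen : open D) (Dsym : conj_symmetric D).
Hypotheses (Fstem : is_stem D F) (Ff : induces D F f) (FC1 : is_C1 D F).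

(* The stem function of the spherical derivative. *)
Let G (z : R * R) : quat R * quat R := z.2^-1 *: ((F z).2, 0).

Lemma open_off_real : open (off_real D).
Proof.
have -> : off_real D = D `&` (snd @^-1` [set b | b != 0]).
  by apply/seteqP; split => -[].
apply: openI => //; apply: open_comp; last exact: open_neq.
by move=> z _; exact: cvg_snd.
Qed.

Lemma conj_symmetric_off_real : conj_symmetric (off_real D).
Proof.
by move=> a b [/= Dab b0]; split => /=; [exact: Dsym|rewrite oppr_eq0].
Qed.

(** By the parity of the stem, f(x) - f(x^c) = 2 J F_2, and J^2 = -1 removes the unit. *)
Lemma spherical_stem_induces : induces (off_real D) G (spherical_derivative f).
Proof.
move=> a b J [/= Dab b0] J1; have [F1 F2] := Fstem Dab.
rewrite -/(slice_pt J a b) spherical_derivative_slice_pt// /slice_pt.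
rewrite (Ff Dab J1) (Ff (Dsym Dab) J1) F1 F2 /= scaler0 mulr0 addr0.
rewrite scale0r add0r [J * - _]mulrN opprB [X in _ * X]addrC [X in _ * X]addrA.
rewrite addrNK -mulr2n -[(J * _) *+ 2]scaler_nat -scalerAl -scalerAr mulrA.
rewrite -expr2 J1 mulN1r !scalerN scalerA.
by rewrite -scaleNr; congr (_ *: _); field.
Qed.

(** [stem_of] is a choice; [G] is a candidate for it, and stem functions inducing the same function
    agree on the domain. *)
Lemma stem_ofE z : off_real D z ->
  stem_of (off_real D) (spherical_derivative f) z = G z.
Proof.
move=> Dz; have Gind := spherical_stem_induces.
have Gstem : is_stem (off_real D) G.
  move=> a b [/= Dab b0]; have [_ F2] := Fstem Dab.
  by rewrite /G /= F2 scalerN invrN scaleNr opprK !scaler0 oppr0.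
have [] := @xgetPex _ (fun=> 0) [set H | is_stem (off_real D) H /\
  induces (off_real D) H (spherical_derivative f)]; first by exists G.
by rewrite -/(stem_of _ _) => _ Sind; exact: (induces_inj Sind Gind).
Qed.

Lemma derivable_stem_of z v : off_real D z -> derivable F z v ->
  derivable (stem_of (off_real D) (spherical_derivative f)) z v.
Proof.
move=> Dz dF; apply: (@near_eq_derivable _ _ _ G).
  have : \forall w \near z, off_real D w.
    by apply: open_nbhs_nbhs; split=> //; exact: open_off_real.
  by apply: filterS => w /stem_ofE.
rewrite /G.
refine (@derivable_scaler R (R * R)%type (quat R * quat R)%type
  (fun w => w.2^-1) (fun w => ((F w).2, 0)) z v _ _).
  by apply: derivableV; [case: Dz|exact: derivable_snd].
apply/cvg_ex; exists (('D_v F z).2, 0) => /=.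
have : ((h^-1 *: ((F \o shift z) (h *: v) - F z)).2, 0 : quat R) @[h --> 0^']
    --> (('D_v F z).2, 0 : quat R).
  refine (cvg_pair (G := nbhs ('D_v F z).2) (H := nbhs (0 : quat R)) _ _).
    have csnd : snd @ 'D_v F z --> ('D_v F z).2 by exact: cvg_snd.
    exact: (cvg_comp _ _ (dF : _ --> 'D_v F z) csnd).
  exact: cvg_cst.
apply: cvg_trans; apply: near_eq_cvg; near=> h.
by congr (_, _); rewrite /= subrr scaler0.
Unshelve. all: by end_near. Qed.

(** The operator [d_z] mixes both components of both partial derivatives; these four errors are at
    most k each and are halved, whence 2k. [la] and [lb] stand for the derivatives in a and in b. *)
Lemma slice_derivative_dist_le J a b (la lb : quat R) (k : R) :
  imag_unit J -> D (a, b) -> 0 < b ->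
  (\forall h \near 0^', `|spherical_derivative f (slice_pt J (a + h) b) -
    spherical_derivative f (slice_pt J a b) - h *: la| <= k * `|h|) ->
  (\forall h \near 0^', `|spherical_derivative f (slice_pt J a (b + h)) -
    spherical_derivative f (slice_pt J a b) - h *: lb| <= k * `|h|) ->
  `|slice_derivative (off_real D) (spherical_derivative f) (slice_pt J a b) -
    2^-1 *: (la - J * lb)| <= 2 * k.
Proof.
move=> J1 Dab b0 ha hb.
have Dz : off_real D (a, b) by split=> //=; rewrite gt_eqF.
pose S := stem_of (off_real D) (spherical_derivative f).
have SE a' b' : off_real D (a', b') ->
    S (a', b') = (spherical_derivative f (slice_pt J a' b'), 0).
  move=> D'; rewrite /S stem_ofE// /slice_pt (spherical_stem_induces D' J1).
  by congr (_, _); rewrite /= scaler0 ?mulr0 ?addr0.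
have [dFa dFb _ _] := FC1 Dab.
have Dline v : \forall h \near 0^', off_real D ((a, b) + h *: v).
  have cv : (a, b) + h *: v @[h --> 0^'] --> (a, b) + 0 *: v.
    apply: cvgD; first exact: cvg_cst.
    apply: cvgZ; last exact: cvg_cst.
    by apply: cvg_within_filter; exact: cvg_id.
  have Dn : nbhs ((a, b) + 0 *: v) (off_real D).
    rewrite scale0r addr0.
    by apply: open_nbhs_nbhs; split=> //; exact: open_off_real.
  exact: cv Dn.
have nearS v (l : quat R) : derivable F (a, b) v ->
    (\forall h \near 0^', `|spherical_derivative f
      (slice_pt J (a + h * v.1) (b + h * v.2)) -
      spherical_derivative f (slice_pt J a b) - h *: l| <= k * `|h|) ->
    `|('D_v S (a, b)).1 - l| <= k /\ `|('D_v S (a, b)).2| <= k.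
  move=> /(derivable_stem_of Dz) dS hl.
  suff : `|'D_v S (a, b) - (l, 0)| <= k.
    by rewrite prod_normE /= subr0 ge_max => /andP[].
  apply: derive_dist_le => //; have Dv := Dline v; near=> h.
  have Dh : off_real D (a + h * v.1, b + h * v.2) by near: h; exact: Dv.
  rewrite [(a, b) + _](_ : _ = (a + h * v.1, b + h * v.2))// !SE// prod_normE /=.
  by rewrite scaler0 !subr0 normr0 max_l//; near: h.
have {ha}[a1 a2] : `|('D_(1, 0) S (a, b)).1 - la| <= k /\
    `|('D_(1, 0) S (a, b)).2| <= k.
  by apply: nearS => //; apply: filterS ha => h; rewrite /= mulr1 mulr0 addr0.
have {hb}[b1 b2] : `|('D_(0, 1) S (a, b)).1 - lb| <= k /\
    `|('D_(0, 1) S (a, b)).2| <= k.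
  by apply: nearS => //; apply: filterS hb => h; rewrite /= mulr1 mulr0 addr0.
(* Since b > 0, the normal form used by [slice_fun] has unit [J] and imaginary coordinate b. *)
rewrite /slice_derivative /slice_fun quat_im_slice_pt// qre_slice_pt//.
rewrite normrZ (imag_unit_norm J1) mulr1 gtr0_norm// scalerK ?gt_eqF//.
rewrite -/S /d_z /sqrtN1_mul /=.
move: ('D_(1, 0) S (a, b)) ('D_(0, 1) S (a, b)) a1 a2 b1 b2.
move=> [da1 da2] [db1 db2] /= a1 a2 b1 b2.
have -> : 2^-1 *: (da1 - - db2) + J * (2^-1 *: (da2 - db1)) -
    2^-1 *: (la - J * lb) =
    2^-1 *: ((da1 - la) + db2 + (J * da2 - J * (db1 - lb))).
  rewrite opprK -scalerAr -scalerDr -scalerBr; congr (_ *: _).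
  by rewrite !mulrBr !opprB !addrA [LHS](ACl (1*6*2*3*5*4)).
have hJ (q : quat R) : `|J * q| = `|q|.
  by rewrite quat_normM (imag_unit_norm J1) mul1r.
rewrite normrZ ger0_norm// ler_pdivrMl//.
apply: (le_trans (ler_normD _ _)).
apply: (le_trans (lerD (ler_normD _ _) (ler_normB _ _))).
rewrite !hJ; lra.
Unshelve. all: by end_near. Qed.

End SphericalStem.

(** * Nonreal center *)

Section NonReal.
Context (R : realType).
Implicit Types (f g : quat R -> quat R) (s : nat -> quat R) (x y J : quat R).

(** The terms of index 0 to 3, cut after a full pair so that the remainder starts at Delta^2. *)
Definition spherical_cubic x s y : quat R :=
  s 0%N + (y - x) * s 1%N + Delta x y * (s 2%N + (y - x) * s 3%N).

(** Paired, the terms are Delta^n (s_2n + (y - x) s_(2n+1)), with a geometric majorant of ratio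
    |Delta|/t^2. The bound [B] on |y - x| may be large: the estimate also serves at conjugate
    points, where y is far from x while Delta is small. *)
Lemma spherical_expansion_remainder (D : set (R * R)) f x s (B : R) :
  is_spherical_expansion D f x s ->
  exists K r : R, [/\ 0 <= K, 0 < r & forall y, `|y - x| <= B ->
    `|Delta x y| <= r ->
    `|f y - spherical_cubic x s y| <= K * `|Delta x y| ^+ 2].
Proof.
move=> fs; have [C [t [C0 t0 sb]]] := spherical_coef_bound fs.
case: fs => r [r0 _ fs].
(* The first radius keeps y in the Cassini ball, the second makes the ratio at most 1/2; t^-4 comes
   from the squared ratio. *)
exists (2 * (C * (1 + `|B| / t)) * t^-1 ^+ 4), (Num.min (r ^+ 2 / 2) (t ^+ 2 / 2)).
have tV0 : 0 <= t^-1 by rewrite invr_ge0 ltW.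
have K0 : 0 <= C * (1 + `|B| / t) by rewrite mulr_ge0// addr_ge0// mulr_ge0.
split.
- by rewrite mulr_ge0 ?exprn_ge0// mulr_ge0.
- by rewrite lt_min !divr_gt0// exprn_gt0.
move=> y yB; rewrite le_min => /andP[yr yt].
have fy : series (fun n => spherical_basis x n y * s n) @ \oo --> f y.
  apply: fs; rewrite Cassini_ballE//; apply: (le_lt_trans yr).
  by rewrite ltr_pdivrMr// ltr_pMr ?exprn_gt0// ltrDl.
have /= := @cvg_series_tail _ _ _ _ (C * (1 + `|B| / t))
  (`|Delta x y| * t^-1 ^+ 2) 2 K0 _ _ (cvg_series_pair fy).
rewrite exprMn -exprM /series /= !big_nat_recr//= big_geq// add0r.
rewrite /spherical_basis /= expr0 !mul1r expr1 -mulrA -mulrDr.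
rewrite -/(spherical_cubic x s y) => le_rem.
rewrite -mulrA [_ ^+ 4 * _]mulrC; apply: le_rem.
  rewrite mulr_ge0 ?exprn_ge0//= exprVn ler_pdivrMr ?exprn_gt0//.
  by rewrite mulrC.
move=> n _; rewrite /= odd_double /= doubleK uphalf_double -mulrA -mulrDr.
rewrite quat_normM quat_normX exprMn -exprM mul2n [leRHS]mulrCA ler_wpM2l ?exprn_ge0//.
apply: (le_trans (ler_normD _ _)); rewrite quat_normM.
apply: (@le_trans _ _ (C * t^-1 ^+ n.*2 + `|B| * (C * t^-1 ^+ n.*2.+1))).
  by apply: lerD => //; apply: ler_pM => //; apply: le_trans (ler_norm _).
by rewrite exprS le_eqVlt; apply/orP; left; apply/eqP; ring.
Qed.

Lemma spherical_derivativeB f g x :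
  spherical_derivative f x - spherical_derivative g x =
  spherical_derivative (fun y => f y - g y) x.
Proof.
by rewrite /spherical_derivative -scalerBr -mulrBr !opprB !addrA
  [f x - _ + _ - _](ACl (1*4*3*2)).
Qed.

Lemma spherical_derivative_norm_le f J a b : imag_unit J -> b != 0 ->
  `|spherical_derivative f (slice_pt J a b)| <=
  (2 * `|b|)^-1 * (`|f (slice_pt J a b)| + `|f (slice_pt J a (- b))|).
Proof.
move=> J1 b0; rewrite spherical_derivative_slice_pt// quat_normM.
apply: ler_pM => //; last exact: ler_normB.
apply: (le_trans (norm_slice_pt_le _ _ J1)).
by rewrite normr0 add0r normrN normfV normrM normr_nat.
Qed.

(** The coefficients are the spherical derivatives of z - z0, Delta and Delta (z - z0), all computed
    in the slice of [J]; that of s_3 vanishes at the center. *)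
Lemma spherical_derivative_cubic s J a0 b0 a b : imag_unit J -> b != 0 ->
  spherical_derivative (spherical_cubic (slice_pt J a0 b0) s) (slice_pt J a b) =
  s 1%N + (2 * (a - a0)) *: s 2%N +
  slice_pt J (3 * (a - a0) ^+ 2 + b0 ^+ 2 - b ^+ 2) (- (2 * (a - a0) * b0)) * s 3%N.
Proof.
move=> J1 b_neq0; rewrite spherical_derivative_slice_pt//.
have cubicE b' : spherical_cubic (slice_pt J a0 b0) s (slice_pt J a b') =
    s 0%N + slice_pt J (a - a0) (b' - b0) * s 1%N +
    slice_pt J ((a - a0) ^+ 2 + b0 ^+ 2 - b' ^+ 2) (2 * (a - a0) * b') * s 2%N +
    (slice_pt J ((a - a0) ^+ 2 + b0 ^+ 2 - b' ^+ 2) (2 * (a - a0) * b') *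
      slice_pt J (a - a0) (b' - b0)) * s 3%N.
  by rewrite /spherical_cubic Delta_slice_pt// slice_ptB mulrDr !mulrA addrA.
rewrite !cubicE !slice_ptM// !opprD !addrA.
have -> (t u1 u2 u3 v1 v2 v3 : quat R) :
  t + u1 + u2 + u3 - t - v1 - v2 - v3 = (u1 - v1) + (u2 - v2) + (u3 - v3).
  by rewrite [LHS](ACl (1*5*2*6*3*7*4*8))/= subrr add0r !addrA.
rewrite -!mulrBl !slice_ptB [LHS]mulrDr [X in X + _ = _]mulrDr !mulrA !slice_ptM//.
congr (_ + _ + _).
- rewrite [X in X * _](_ : _ = 1) ?mul1r//.
  by rewrite -[RHS]scale1r -[RHS](slice_pt_real J); congr slice_pt; field.
- rewrite [X in X * _](_ : _ = (2 * (a - a0))%:A).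
    by rewrite -scalerAl mul1r.
  by rewrite -[RHS](slice_pt_real J); congr slice_pt; field.
- by congr (slice_pt _ _ _ * _); field.
Qed.

Lemma spherical_derivative_expansion (D : set (R * R)) f s J a0 b0 (k : R) :
  imag_unit J -> 0 < b0 -> is_spherical_expansion D f (slice_pt J a0 b0) s ->
  0 < k ->
  (\forall h \near 0^', `|spherical_derivative f (slice_pt J (a0 + h) b0) -
    spherical_derivative f (slice_pt J a0 b0) -
    h *: (2 *: s 2%N - (2 * b0) *: (J * s 3%N))| <= k * `|h|) /\
  (\forall h \near 0^', `|spherical_derivative f (slice_pt J a0 (b0 + h)) -
    spherical_derivative f (slice_pt J a0 b0) -
    h *: (- (2 * b0) *: s 3%N)| <= k * `|h|).
Proof.
move=> J1 b0_gt0 fs k0; set x0 := slice_pt J a0 b0.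
(* 4 + 4 b0 bounds the distance to x0 of a + Jb and of a - Jb when |a - a0| and |b - b0| are at most
   1. *)
have [K [r [K0 r0 remP]]] :=
  spherical_expansion_remainder (4 + 4 * b0) fs.
(* For a displacement |h| <= 1 along a or b, |Delta| <= h^2 + 2 b0 |h| <= M |h|. *)
pose c := spherical_cubic x0 s; pose M := 1 + 2 * b0.
have M0 : 0 < M by rewrite /M; lra.
(* The error is quadratic because Delta vanishes on the sphere of x0. *)
have remE a b d : `|a - a0| <= 1 -> `|b - b0| <= 1 -> b0 / 2 <= b ->
    0 <= d -> M * d <= r ->
    `|(a - a0) ^+ 2 + b0 ^+ 2 - b ^+ 2| + `|2 * (a - a0) * b| <= M * d ->
    `|spherical_derivative f (slice_pt J a b) -
      spherical_derivative c (slice_pt J a b)| <= 2 * K * M ^+ 2 / b0 * d ^+ 2.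
  move=> a1 b1 b2 d0 dr Dd.
  have bpos : 0 < b by apply: lt_le_trans b2; rewrite divr_gt0.
  have rem b' : b' = b \/ b' = - b ->
      `|f (slice_pt J a b') - c (slice_pt J a b')| <= K * (M * d) ^+ 2.
    move=> bb'.
    have Dn : `|Delta x0 (slice_pt J a b')| <= M * d.
      rewrite Delta_slice_pt//; apply: (le_trans (norm_slice_pt_le _ _ J1)).
      by case: bb' => ->//; rewrite sqrrN mulrN normrN.
    apply: (@le_trans _ _ (K * `|Delta x0 (slice_pt J a b')| ^+ 2)).
      apply: remP; last exact: le_trans Dn dr.
      rewrite slice_ptB; apply: (le_trans (norm_slice_pt_le _ _ J1)).
      have : `|b' - b0| <= 3 + 4 * b0.
        move: b1; rewrite !ler_norml => /andP[? ?].
        by apply/andP; split; case: bb' => ->; lra.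
      move: a1; lra.
    by rewrite ler_wpM2l// lerXn2r ?nnegrE// mulr_ge0// ltW.
  rewrite spherical_derivativeB.
  apply: (le_trans (spherical_derivative_norm_le _ a J1 _)); first by rewrite gt_eqF.
  apply: (@le_trans _ _ ((2 * `|b|)^-1 * (2 * (K * (M * d) ^+ 2)))).
    rewrite ler_wpM2l ?invr_ge0 ?mulr_ge0// mulr_natl mulr2n.
    by apply: lerD; apply: rem; [left|right].
  rewrite gtr0_norm// invfM mulrACA mulVf// mul1r.
  have -> : 2 * K * M ^+ 2 / b0 * d ^+ 2 = (2 / b0) * (K * (M * d) ^+ 2).
    by field; rewrite gt_eqF.
  rewrite ler_wpM2r//; first by rewrite mulr_ge0// exprn_ge0// mulr_ge0// ltW.
  (* Here b >= b0/2 enters: 1/b <= 2/b0. *)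
  rewrite -[2 / b0]invf_div lef_pV2 ?posrE// divr_gt0//.
pose K' := 2 * K * M ^+ 2 / b0.
have K'0 : 0 <= K' by rewrite /K' divr_ge0 ?(ltW b0_gt0)// !mulr_ge0// ltW.
(* With d = 0 the error bound of [remE] is zero, so the truncation gives the value at x0. *)
have sd0 : spherical_derivative f x0 = s 1%N.
  have cE : spherical_derivative c x0 = s 1%N.
    rewrite /c spherical_derivative_cubic ?gt_eqF// subrr !mulr0 mul0r oppr0.
    rewrite scale0r addr0 expr0n/= mulr0 add0r subrr slice_pt_real scale0r.
    by rewrite mul0r addr0.
  apply/eqP; rewrite -subr_eq0 -normr_eq0 -normr_le0 normr_id -cE.
  apply: (le_trans (remE a0 b0 0 _ _ _ _ _ _)); rewrite ?subrr ?normr0//.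
  - by rewrite ler_pdivrMr//; lra.
  - by rewrite mulr0 ltW.
  - by rewrite expr0n/= add0r subrr !mulr0 mul0r normr0 add0r.
  - by rewrite expr0n/= mulr0.
(* Two quadratic errors add up to at most k|h| once |h| <= k/(K' + m + 1); the 1 keeps the
   denominator positive. *)
have quad (h : R) (u v w : quat R) (m : R) : 0 <= m ->
    `|u - v| <= K' * `|h| ^+ 2 -> `|v - w| <= m * `|h| ^+ 2 ->
    `|h| <= k / (K' + m + 1) -> `|u - w| <= k * `|h|.
  move=> m0 uv vw hk; rewrite -(subrKA v).
  apply: (le_trans (ler_normD _ _)); apply: (le_trans (lerD uv vw)).
  rewrite -mulrDl expr2 mulrA ler_wpM2r//.
  move: hk; rewrite ler_pdivlMr; last by lra.
  have := normr_ge0 h; nra.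
have dist1 (h : R) : `|h| <= 1 -> `|h| ^+ 2 + 2 * b0 * `|h| <= M * `|h|.
  by move=> h1; have := normr_ge0 h; rewrite /M; nra.
have addrKl (u v : R) : u + v - u = v by ring.
split; near=> h.
- have h1 : `|h| <= 1 by near: h; exact: dnbhs0_le.
  have hr : M * `|h| <= r.
    rewrite mulrC -ler_pdivlMr//; near: h; apply: dnbhs0_le; exact: divr_gt0.
  rewrite sd0 -addrA -opprD.
  (* Beyond first order the truncation leaves 3 h^2 s_3 here, and - h^2 s_3 in the direction of
     b. *)
  apply: (quad h _ (spherical_derivative c (slice_pt J (a0 + h) b0)) _
    (3 * `|s 3%N|)).
  + by rewrite mulr_ge0.
  + apply: remE => //; first by rewrite addrKl.
    * by rewrite subrr normr0.
    * by rewrite ler_pdivrMr//; lra.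
    * apply: le_trans (dist1 _ h1); rewrite addrKl addrK.
      by rewrite normrX lerD2l !normrM normr_nat (gtr0_norm b0_gt0) mulrAC.
  + rewrite /c spherical_derivative_cubic ?gt_eqF// addrKl addrK.
    set w := (X in `|X|); suff -> : w = (3 * h ^+ 2) *: s 3%N.
      by rewrite normrZ normrM normr_nat normrX mulrAC.
    rewrite /w -[s 1%N + _ + _]addrA opprD addrACA subrr add0r.
    rewrite slice_ptMl scalerBr !scalerA [h * 2]mulrC scaleNr opprB.
    rewrite [2 * h * b0](_ : _ = h * (2 * b0)); last by ring.
    by rewrite !addrA [LHS](ACl (1*5*4*3*2))/= subrr add0r subrr add0r.
  + near: h; apply: dnbhs0_le; rewrite divr_gt0// ltr_wpDl// addr_ge0// mulr_ge0//.
- have h1 : `|h| <= 1 by near: h; exact: dnbhs0_le.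
  have hr : M * `|h| <= r.
    rewrite mulrC -ler_pdivlMr//; near: h; apply: dnbhs0_le; exact: divr_gt0.
  (* This keeps the moved point nonreal, at height at least b0/2. *)
  have hb : `|h| <= b0 / 2 by near: h; apply: dnbhs0_le; exact: divr_gt0.
  have hb' : b0 / 2 <= b0 + h.
    by move: hb; rewrite ler_norml => /andP[? _]; lra.
  rewrite sd0 -addrA -opprD.
  apply: (quad h _ (spherical_derivative c (slice_pt J a0 (b0 + h))) _ `|s 3%N|).
  + by [].
  + apply: remE => //.
    * by rewrite subrr normr0.
    * by rewrite addrKl.
    * apply: le_trans (dist1 _ h1); rewrite subrr expr0n/= add0r !(mulr0, mul0r).
      rewrite normr0 addr0 (_ : _ - _ = - (h ^+ 2 + 2 * b0 * h)); last by ring.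
      rewrite normrN; apply: (le_trans (ler_normD _ _)).
      by rewrite normrX !normrM normr_nat (gtr0_norm b0_gt0).
  + rewrite /c spherical_derivative_cubic; last first.
    * by rewrite gt_eqF//; apply: lt_le_trans hb'; rewrite divr_gt0.
    * by [].
    set w := (X in `|X|); suff -> : w = (- h ^+ 2) *: s 3%N.
      by rewrite normrZ normrN normrX mulrC.
    rewrite /w subrr !mulr0 mul0r oppr0 scale0r addr0 opprD addrACA subrr add0r.
    rewrite slice_ptMl scale0r addr0 scalerA -scalerBl; congr (_ *: _).
    by rewrite expr0n/=; ring.
  + near: h; apply: dnbhs0_le; rewrite divr_gt0// ltr_wpDl// addr_ge0//.
Unshelve. all: by end_near. Qed.


End NonReal.

(** * Real center *)

Section RealCenter.
Context (R : realType).
Implicit Types (f : quat R -> quat R) (s : nat -> quat R) (x y J c : quat R).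
Implicit Types (a b d e : R).

(** Only b^2 enters the recursion. *)
Lemma slice_powN a b n : slice_pow a (- b) n = slice_pow a b n.
Proof. by elim: n => [//|n /= ->]; rewrite sqrrN. Qed.

(** t is homogeneous of degree n and u of degree n - 1, whence the weight e on u; each step of the
    recursion adds two terms, each at most e times the previous bound. *)
Lemma slice_pow_le a b e n : 0 < e -> `|a| <= e -> `|b| <= e ->
  `|(slice_pow a b n).1| <= (2 * e) ^+ n /\
  `|(slice_pow a b n).2| * e <= (2 * e) ^+ n.
Proof.
move=> e0 ae be; elim: n => [|n]; first by rewrite /= normr1 normr0 mul0r.
rewrite /= ![_ ^+ n.+1]exprS; case: slice_pow => t u /= [].
move: (_ ^+ n) => p tp up; have := normr_ge0 u; have := normr_ge0 t => t0 u0.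
have b2 : `|b| ^+ 2 <= e ^+ 2 by rewrite lerXn2r ?nnegrE// ltW.
split.
  apply: (le_trans (ler_normB _ _)); rewrite normrM [`|b ^+ 2 * u|]normrM normrX.
  have : `|a| * `|t| <= e * p by apply: ler_pM.
  have : `|b| ^+ 2 * `|u| <= e ^+ 2 * `|u| by apply: ler_wpM2r.
  nra.
apply: (@le_trans _ _ ((`|t| + `|a| * `|u|) * e)).
  by rewrite ler_wpM2r ?(ltW e0)// -normrM ler_normD.
have : `|a| * (`|u| * e) <= e * p by apply: ler_pM => //; rewrite mulr_ge0// ltW.
nra.
Qed.

(** The factor d takes up one degree, whence the weights e and e^2. The factor 5 = 1 + 1 + 1 + 2
    counts the terms of the real part, where b'^2 - b^2 contributes 2 e d. *)
Lemma slice_pow_lip a b a' b' d e n : 0 < e ->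
  `|a| <= e -> `|b| <= e -> `|a'| <= e -> `|b'| <= e ->
  `|a' - a| <= d -> `|b' - b| <= d ->
  `|(slice_pow a' b' n).1 - (slice_pow a b n).1| * e <= (5 * e) ^+ n * d /\
  `|(slice_pow a' b' n).2 - (slice_pow a b n).2| * e ^+ 2 <= (5 * e) ^+ n * d.
Proof.
move=> e0 ae be ae' be' ad bd.
have d0 : 0 <= d by apply: le_trans ad.
have b2 : `|b'| ^+ 2 <= e ^+ 2 by rewrite lerXn2r ?nnegrE// ltW.
have b2d : `|b' ^+ 2 - b ^+ 2| <= 2 * e * d.
  rewrite subr_sqr normrM mulrC; apply: ler_pM => //.
  by apply: (le_trans (ler_normD _ _)); rewrite mulr_natl mulr2n lerD.
elim: n => [|n]; first by rewrite /= !subrr !normr0 !mul0r expr0 mul1r.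
have [] := slice_pow_le n e0 ae be.
have qp : (2 * e) ^+ n <= (5 * e) ^+ n by rewrite lerXn2r ?nnegrE ?mulr_ge0 ?ltW//; lra.
rewrite /= ![_ ^+ n.+1]exprS; case: (slice_pow a' b' n) => t' u'.
case: (slice_pow a b n) => t u /=.
move: ((2 * e) ^+ n) ((5 * e) ^+ n) qp => p q qp tp up [tq uq].
split.
  have -> : a' * t' - b' ^+ 2 * u' - (a * t - b ^+ 2 * u) =
      (a' * (t' - t) + (a' - a) * t) - (b' ^+ 2 * (u' - u) + (b' ^+ 2 - b ^+ 2) * u).
    by ring.
  have h1 : `|a'| * (`|t' - t| * e) <= e * (q * d).
    by apply: ler_pM => //; rewrite mulr_ge0// ltW.
  have h2 : `|a' - a| * `|t| <= d * p by apply: ler_pM.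
  have h3 : `|b'| ^+ 2 * `|u' - u| <= e ^+ 2 * `|u' - u| by apply: ler_wpM2r.
  have h4 : `|b' ^+ 2 - b ^+ 2| * (`|u| * e) <= 2 * e * d * p.
    by apply: ler_pM => //; rewrite mulr_ge0// ltW.
  apply: (@le_trans _ _ ((`|a'| * `|t' - t| + `|a' - a| * `|t| +
      (`|b'| ^+ 2 * `|u' - u| + `|b' ^+ 2 - b ^+ 2| * `|u|)) * e)).
    rewrite ler_wpM2r ?(ltW e0)// -normrX -!normrM.
    by apply: (le_trans (ler_normB _ _)); apply: lerD; exact: ler_normD.
  have h2' := ler_wpM2r (ltW e0) h2.
  have h3' := ler_wpM2r (ltW e0) h3.
  have h5 := ler_wpM2l (ltW e0) uq.
  have h6 := ler_wpM2l (mulr_ge0 d0 (ltW e0)) qp.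
  rewrite !mulrDl; lra.
have -> : t' + a' * u' - (t + a * u) = (t' - t) + a' * (u' - u) + (a' - a) * u.
  by ring.
have h1 : `|a'| * (`|u' - u| * e ^+ 2) <= e * (q * d).
  by apply: ler_pM => //; rewrite mulr_ge0// exprn_ge0// ltW.
have h2 : `|a' - a| * (`|u| * e) <= d * p.
  by apply: ler_pM => //; rewrite mulr_ge0// ltW.
apply: (@le_trans _ _ ((`|t' - t| + `|a'| * `|u' - u| + `|a' - a| * `|u|) * e ^+ 2)).
  rewrite ler_wpM2r ?exprn_ge0 ?(ltW e0)// -!normrM.
  by apply: (le_trans (ler_normD _ _)); rewrite lerD2r ler_normD.
have h2' := ler_wpM2r (ltW e0) h2.
have h5 := ler_wpM2l (ltW e0) tq.
have h6 := ler_wpM2l (mulr_ge0 d0 (ltW e0)) qp.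
rewrite !mulrDl expr2; rewrite expr2 in h1.
have := mulr_ge0 (mulr_ge0 d0 (ltW e0)) (le_trans (normr_ge0 _) (le_trans tp qp)).
lra.
Qed.

Lemma cvg_quat_mull c (u : nat -> quat R) x :
  u @ \oo --> x -> (fun n => c * u n) @ \oo --> c * x.
Proof.
move=> ux; apply/cvgrPdist_le => k k0.
have c0 : 0 < `|c| + 1 by rewrite ltr_wpDl.
have : \forall n \near \oo, `|x - u n| <= k / (`|c| + 1).
  by move/cvgrPdist_le : ux; apply; exact: divr_gt0.
apply: filterS => n; rewrite ler_pdivlMr// -mulrBr quat_normM.
have := normr_ge0 (x - u n); nra.
Qed.

(** At a real center Delta is (y - a0)^2, so the expansion is an ordinary power series. *)
Lemma spherical_basis_real a0 n y :
  spherical_basis a0%:A n y = (y - a0%:A) ^+ n.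
Proof.
have -> : spherical_basis a0%:A n y =
    (y - a0%:A) ^+ 2 ^+ n./2 * (y - a0%:A) ^+ odd n.
  have DE : Delta a0%:A y = (y - a0%:A) ^+ 2.
    by case: y => ????; rewrite /Delta !expr2; congr Quat => /=; ring.
  by rewrite /spherical_basis DE; case: odd; rewrite ?expr1 ?expr0 ?mulr1.
by rewrite -exprM -exprD mul2n addnC odd_double_half.
Qed.

(** Termwise, (z^n - conj z^n)/(2bJ) is the real number u_n of [slice_pow], the same for every
    [J]. *)
Lemma spherical_derivative_series (D : set (R * R)) f s a0 :
  is_spherical_expansion D f a0%:A s ->
  exists2 r : R, 0 < r & forall J a b, imag_unit J -> b != 0 ->
    `|a - a0| <= r -> `|b| <= r ->
    series (fun n => (slice_pow (a - a0) b n).2 *: s n) @ \oo -->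
      spherical_derivative f (slice_pt J a b).
Proof.
(* |a - a0| + |b| <= r/2 puts both conjugate points in the Cassini ball. *)
move=> [r [r0 _ fs]]; exists (r / 4); first by rewrite divr_gt0.
move=> J a b J1 b0 ar br; rewrite spherical_derivative_slice_pt//.
have sub_real b' : slice_pt J a b' - a0%:A = slice_pt J (a - a0) b'.
  by rewrite -(slice_pt_real J) slice_ptB subr0.
have fE b' : `|b'| <= r / 4 ->
    series (fun n => slice_pt J (a - a0) b' ^+ n * s n) @ \oo -->
    f (slice_pt J a b').
  move=> b'r; under eq_fun do rewrite -sub_real -spherical_basis_real.
  apply: fs; rewrite Cassini_ballE//.
  have := spherical_basis_real a0 2 (slice_pt J a b').
  rewrite {1}/spherical_basis/= expr1 => ->.
  rewrite quat_normX ltrXn2r ?nnegrE ?(ltW r0)// sub_real.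
  apply: (le_lt_trans (norm_slice_pt_le _ _ J1)); lra.
have bNr : `|- b| <= r / 4 by rewrite normrN.
set S := series _; pose c := slice_pt J 0 (- (2 * b)^-1).
suff -> : S = (fun n => c *
    (series (fun k => slice_pt J (a - a0) b ^+ k * s k) n -
     series (fun k => slice_pt J (a - a0) (- b) ^+ k * s k) n)).
  exact: cvg_quat_mull (cvgB (fE _ br) (fE _ bNr)).
apply/funext => n; rewrite /S /c.
rewrite /= /series /= -sumrB mulr_sumr; apply: eq_bigr => k _.
rewrite -mulrBl mulrA !slice_ptX// slice_powN slice_ptB subrr slice_ptM//.
rewrite !(mul0r, mulr0, addr0, add0r) slice_ptMl scale0r addr0.
by congr (_ *: _); field.
Qed.

(* The tail of order n >= 3 has a Lipschitz constant O(e) on the disc of radius e,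
   so its partial derivatives vanish in the limit at the center. *)
Lemma spherical_derivative_lip (D : set (R * R)) f s a0 :
  is_spherical_expansion D f a0%:A s ->
  exists K r : R, [/\ 0 <= K, 0 < r & forall J a b a' b' d e, imag_unit J ->
    0 < e -> e <= r -> b != 0 -> b' != 0 ->
    `|a - a0| <= e -> `|b| <= e -> `|a' - a0| <= e -> `|b'| <= e ->
    `|a' - a| <= d -> `|b' - b| <= d ->
    `|spherical_derivative f (slice_pt J a' b') -
      spherical_derivative f (slice_pt J a b) - (2 * (a' - a)) *: s 2%N|
    <= K * e * d].
Proof.
move=> fs; have [C [t [C0 t0 sb]]] := spherical_coef_bound fs.
have [r r0 ser] := spherical_derivative_series fs.
(* e <= t/10 makes the ratio 5e/t at most 1/2; 250 = 2 * 5^3 comes from the tail bound at order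
   3. *)
exists (250 * C / t ^+ 3), (Num.min r (t / 10)); split.
- by apply: divr_ge0; [exact: mulr_ge0|rewrite exprn_ge0// ltW].
- by rewrite lt_min r0 divr_gt0.
move=> J a b a' b' d e J1 e0; rewrite le_min => /andP[er et] b0 b0' ae be ae' be' ad bd.
have d0 : 0 <= d by apply: le_trans ad.
have := @cvg_series_tail _ _ (fun n => ((slice_pow (a' - a0) b' n).2 -
  (slice_pow (a - a0) b n).2) *: s n) (spherical_derivative f (slice_pt J a' b') -
  spherical_derivative f (slice_pt J a b)) (C * d / e ^+ 2) (5 * e / t) 3.
rewrite {2}/series /= !big_nat_recr//= big_geq//.
(* u_0 = 0 and u_1 = 1 drop out of the difference, and u_2 = 2(a - a0). *)
rewrite [X in _ - _ - X](_ : _ = (2 * (a' - a)) *: s 2%N); last first.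
  rewrite !(mulr1, mulr0, subrr, scale0r, add0r, addr0, subr0).
  by congr (_ *: _); ring.
have -> : 2 * (C * d / e ^+ 2) * (5 * e / t) ^+ 3 = 250 * C / t ^+ 3 * e * d.
  by field; rewrite !gt_eqF.
apply.
- by apply: divr_ge0; [exact: mulr_ge0|rewrite exprn_ge0// ltW].
- apply/andP; split; first by rewrite divr_ge0 ?mulr_ge0// ltW.
  by rewrite ler_pdivrMr//; lra.
- move=> n _; rewrite normrZ exprMn.
  have [] := @slice_pow_lip (a - a0) b (a' - a0) b' d e n e0 ae be ae' be'.
    by rewrite opprB addrA subrK.
    by [].
  move=> _; rewrite -ler_pdivlMr ?exprn_gt0// => h.
  apply: (le_trans (ler_pM _ _ h (sb n))) => //.
  by rewrite le_eqVlt; apply/orP; left; apply/eqP; ring.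
- set S := series _; suff -> : S = (fun n =>
      series (fun k => (slice_pow (a' - a0) b' k).2 *: s k) n -
      series (fun k => (slice_pow (a - a0) b k).2 *: s k) n).
    by apply: cvgB; apply: ser => //; apply: le_trans er.
  apply/funext => n; rewrite /S /series /= -sumrB.
  by apply: eq_bigr => k _; rewrite scalerBl.
Qed.

End RealCenter.

(** * Value off the reals and limit at a real point *)

Section Limit.
Context (R : realType).
Implicit Types (D : set (R * R)) (f : quat R -> quat R) (s : nat -> quat R).
Implicit Types (x y J : quat R).

Lemma quat_im_norm_le x : `|quat_im x| <= `|x|.
Proof.
rewrite !quat_normE ler_sqrt ?quat_normsq_ge0// /quat_normsq /=.
by rewrite expr0n/= add0r -!addrA lerDr sqr_ge0.
Qed.

Lemma Omega_slice D x : conj_symmetric D -> Omega D x ->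
  D (qre x, `|quat_im x|).
Proof.
move=> Dsym [a [b [J [Dab J1 ->]]]].
rewrite -/(slice_pt J a b) qre_slice_pt// quat_im_slice_pt// normrZ.
rewrite (imag_unit_norm J1) mulr1.
by case: (ger0P b) => // _; exact: Dsym.
Qed.

(** By openness the points a + bi with small nonzero b lie over D. This makes the punctured filter
    at a real point proper, so that its limit is unique. *)
Lemma closure_off_real D a : open D -> D (a, 0) ->
  closure (Omega (off_real D)) (a%:A : quat R).
Proof.
move=> Dopen Da B Bx; pose J : quat R := Quat 0 1 0 0.
have J1 : imag_unit J := @imag_unit_i R.
have id0 : (fun b : R => b) @ 0^' --> (0 : R).
  by apply: cvg_within_filter; exact: cvg_id.
have cB : slice_pt J a b @[b --> 0^'] --> (a%:A : quat R).
  rewrite -[X in _ --> X](slice_pt_real J).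
  by apply: cvgD; [exact: cvg_cst|apply: cvgZ => //; exact: cvg_cst].
have cD : (a, b) @[b --> 0^'] --> ((a, 0) : R * R).
  refine (cvg_pair (G := nbhs a) (H := nbhs (0 : R)) _ id0); exact: cvg_cst.
have Dn : nbhs ((a, 0) : R * R) D by exact: open_nbhs_nbhs.
have nearb : \forall b \near (0 : R)^', [/\ B (slice_pt J a b), D (a, b) & b != 0].
  near=> b; split.
  - by near: b; exact: cB.
  - by near: b; exact: cD.
  - by near: b; exact: nbhs_dnbhs_neq.
have PF : ProperFilter ((0 : R)^') by exact: Proper_dnbhs_numFieldType.
have [b [Bb Db b0]] := @filter_ex _ _ PF _ nearb.
by exists (slice_pt J a b); split=> //; exists a, b, J; split.
Unshelve. all: by end_near. Qed.

Lemma slice_derivative_nonreal D f x s : open D -> conj_symmetric D ->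
  slice_regular D f -> Omega D x -> is_spherical_expansion D f x s ->
  quat_im x != 0 ->
  slice_derivative (off_real D) (spherical_derivative f) x = s 2%N.
Proof.
move=> Dopen Dsym [F [Fstem Ff FC1 _]] xD fs imx.
have b0 : 0 < `|quat_im x| by rewrite normr_gt0.
have Dab := Omega_slice Dsym xD; have [] := slice_pt_decomp imx.
set J := _ *: _ => J1 xE; rewrite xE in fs *.
move: J (qre x) `|quat_im x| fs b0 Dab J1 {imx xE xD} => J a b fs b0 Dab J1.
apply/eqP; rewrite -subr_eq0 -normr_le0; apply/ler_addgt0Pr => k k0.
have k20 : 0 < k / 2 by rewrite divr_gt0.
have [ha hb] := spherical_derivative_expansion J1 b0 fs k20.
have := slice_derivative_dist_le Dopen Dsym Fstem Ff FC1 J1 Dab b0 ha hb.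
(* The s_3 terms of the two partial derivatives cancel. *)
rewrite -scalerAr scaleNr opprK subrK scalerA mulVf// scale1r.
by rewrite mulrC divfK// add0r.
Qed.

Lemma slice_derivative_cvg_real D f a s : open D -> conj_symmetric D ->
  slice_regular D f -> is_spherical_expansion D f a%:A s ->
  slice_derivative (off_real D) (spherical_derivative f) x
    @[x --> nonreal_nbhs D a%:A] --> s 2%N.
Proof.
move=> Dopen Dsym [F [Fstem Ff FC1 _]] fs.
have [K [r [K0 r0 lip]]] := spherical_derivative_lip fs.
apply/cvgrPdist_le => eps eps0.
(* The bound K e is doubled by [slice_derivative_dist_le], whence 2 K e <= eps; K + 1 is positive
   even if K = 0. *)
pose e := Num.min r (eps / (2 * (K + 1))).
have K1 : 0 < 2 * (K + 1) by rewrite mulr_gt0// ltr_wpDl.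
have e0 : 0 < e by rewrite lt_min r0 divr_gt0.
have er : e <= r by rewrite ge_min lexx.
have eK : 2 * (K * e) <= eps.
  have : e <= eps / (2 * (K + 1)) by rewrite ge_min lexx orbT.
  by rewrite ler_pdivlMr//; nra.
have near_e : \forall x \near nonreal_nbhs D a%:A, `|(x : quat R) - a%:A| < e.
  rewrite /nonreal_nbhs near_withinE.
  by apply/nbhs_normP; exists e => //= y; rewrite distrC => ye _.
near=> x.
have xO : Omega (off_real D) x by near: x; exact: withinT.
have xe : `|x - a%:A| < e.
  by near: x; exact: near_e.
have [/= Dx imx0] := Omega_slice (conj_symmetric_off_real Dsym) xO.
have imx : quat_im x != 0 by rewrite -normr_eq0.
have b0 : 0 < `|quat_im x| by rewrite normr_gt0.
(* Strict inequalities leave room for small displacements h within radius e. *)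
have ae : `|qre x - a| < e.
  apply: le_lt_trans xe; apply: le_trans (normr_qre_le _).
  by rewrite /= mulr1.
have be : `|quat_im x| < e.
  apply: le_lt_trans xe; apply: le_trans (quat_im_norm_le _).
  suff -> : quat_im (x - a%:A) = quat_im x by [].
  by case: (x) => ????; congr Quat => /=; ring.
rewrite distrC; have [] := slice_pt_decomp imx; set J := _ *: _ => J1 ->.
move: J (qre x) `|quat_im x| b0 ae be Dx J1 => J a' b b0 ae be Dx J1.
have near_line (u v : R) (l : quat R) : l = (2 * u) *: s 2%N ->
    `|u| <= 1 -> `|v| <= 1 ->
    \forall h \near 0^', `|spherical_derivative f
      (slice_pt J (a' + h * u) (b + h * v)) -
      spherical_derivative f (slice_pt J a' b) - h *: l| <= K * e * `|h|.
  move=> -> u1 v1; near=> h.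
  have hn (w : R) : `|w| <= 1 -> `|h * w| <= `|h|.
    by move=> w1; rewrite normrM ler_piMr.
  have hsmall (c w : R) : `|w| <= 1 -> `|h| <= e - c -> c + `|h * w| <= e.
    by move=> w1 hc; rewrite -lerBrDl; apply: le_trans hc; exact: hn.
  (* This keeps the moved point nonreal. *)
  have hb : `|h| < b by near: h; exact: dnbhs0_lt.
  have bh : b + h * v != 0.
    apply/eqP => bhv; have := hn v v1.
    have -> : h * v = - b by apply/eqP; rewrite -addr_eq0 addrC bhv.
    by rewrite normrN gtr0_norm// leNgt hb.
  have := lip J a' b (a' + h * u) (b + h * v) `|h| e J1 e0 er.
  rewrite gt_eqF// ![_ + _ * _ - _]addrAC !subrr !add0r.
  rewrite scalerA mulrCA; apply => //; try exact: ltW; try exact: hn.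
  - by rewrite gtr0_norm// ltW.
  - apply: (le_trans (ler_normD _ _)); apply: hsmall => //.
    by near: h; apply: dnbhs0_le; rewrite subr_gt0.
  - apply: (le_trans (ler_normD _ _)); apply: hsmall => //.
    by near: h; apply: dnbhs0_le; rewrite subr_gt0 gtr0_norm.
have := slice_derivative_dist_le Dopen Dsym Fstem Ff FC1 J1 Dx b0
  (la := 2 *: s 2%N) (lb := 0) (k := K * e).
rewrite mulr0 subr0 scalerA mulVf// scale1r => dist_le.
apply: le_trans eK; apply: dist_le.
  have := @near_line 1 0 _ erefl; rewrite normr1 normr0 mulr1.
  move=> /(_ (lexx _) ler01); apply: filterS => h.
  by rewrite mulr1 mulr0 addr0.
have := @near_line 0 1 0; rewrite normr1 normr0 mulr0 scale0r.
move=> /(_ erefl ler01 (lexx _)); apply: filterS => h.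
by rewrite mulr1 mulr0 addr0.
Unshelve. all: by end_near. Qed.

End Limit.

(** The first conjunct gives the equality its meaning at a real x0, since [lim] takes a default
    value when there is no limit. *)
Theorem corollary26 (R : realType) (D : set (R * R)) (f : quat R -> quat R)
    (x0 : quat R) (s : nat -> quat R)
    (Dopen : open D) (Dsym : conj_symmetric D)
    (freg : slice_regular D f) (x0D : Omega D x0)
    (fexp : is_spherical_expansion D f x0 s) :
  let dsf := slice_derivative (off_real D) (spherical_derivative f) in
  (quat_im x0 = 0 -> cvg (dsf x @[x --> nonreal_nbhs D x0])) /\
  s 2%N = real_extension D dsf x0.
Proof.
move=> dsf; rewrite /real_extension; have [im0|imx0] := eqVneq; last first.
  split=> [/eqP|]; first by rewrite (negbTE imx0).
  by rewrite /dsf (slice_derivative_nonreal Dopen Dsym freg x0D fexp).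
have Dx0 := Omega_slice Dsym x0D; rewrite im0 normr0 in Dx0.
have x0E : x0 = (qre x0)%:A.
  by case: (x0) im0 => ???? [-> -> ->]; congr Quat => /=; ring.
rewrite x0E in fexp *.
have dsf_cvg := slice_derivative_cvg_real Dopen Dsym freg fexp.
split=> [_|]; first exact: cvgP dsf_cvg.
apply/esym; apply: cvg_lim dsf_cvg => //.
by apply: within_nbhs_proper; exact: closure_off_real.
Qed.
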